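(* Let $A= k[x_1][x_2;\alpha_2,\delta_2]_p \cdots [x_n;\alpha_n,\delta_n]_p$ be an iterated Poisson polynomial algebra over a field $k$ of characteristic zero, supporting a rational action of a torus $H=(k^\times)^r$ by $k$-algebra automorphisms such that $x_1,\dots,x_n$ are $H$-eigenvectors. Let $\mathfrak h=\operatorname{Lie}H$ act on $A$ as described in the context. Assume that there exist $\eta_1,\dots,\eta_n\in\mathfrak h$ such that $\eta_i.x_j=\alpha_i(x_j)$ for all $i>j$, and such that for each $i$ the $\eta_i$-eigenvalue of $x_i$ is nonzero. Then $A$ has at most $2^n$ $H$-stable Poisson prime ideals.
   Context: A Poisson algebra is a commutative $k$-algebra with a Lie bracket $\{-,-\}$ that is a derivation in each variable. A Poisson ideal is an ideal $I$ with $\{A,I\}\subseteq I$; a Poisson prime ideal is a prime ideal that is a Poisson ideal. If $B$ is a Poisson algebra, $\alpha$ is a Poisson derivation of $B$ (a derivation for both the product and the bracket) and $\delta$ is a derivation of $B$ with $\delta(\{a,b\})=\{\delta(a),b\}+\{a,\delta(b)\}+\alpha(a)\delta(b)-\delta(a)\alpha(b)$ for all $a,b\in B$, then $B[x;\alpha,\delta]_p$ denotes the polynomial ring $B[x]$ with the unique Poisson bracket extending that of $B$ and satisfying $\{x,b\}=\alpha(b)x+\delta(b)$ for $b\in B$. An iterated Poisson polynomial algebra $k[x_1][x_2;\alpha_2,\delta_2]_p\cdots[x_n;\alpha_n,\delta_n]_p$ is built by iterating this construction starting from $k[x_1]$ with zero bracket. An action of $H=(k^\times)^r$ on $A$ by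 $k$-algebra automorphisms is rational if $A$ is the direct sum of its $H$-eigenspaces $A_x$, $x\in X(H)$, where the characters are identified with $\mathbb Z^r$ via $(m_1,\dots,m_r)\mapsto (h\mapsto h_1^{m_1}\cdots h_r^{m_r})$. The Lie algebra $\mathfrak h=\operatorname{Lie}H$ is identified with $k^r$ and acts on $A$ (the differential of the $H$-action) by $\eta.a=(\eta|x)a$ for $a\in A_x$, where $(-|-)$ is the standard dot product on $k^r$. An $\eta$-eigenvalue of an $H$-eigenvector $a\in A_x$ is the scalar $(\eta|x)$. *)

(* Defs.v *)
From HB Require Import structures.
From mathcomp Require Import all_boot all_order all_algebra.
From mathcomp Require Import mpoly.
Set Implicit Arguments. Unset Strict Implicit. Unset Printing Implicit Defensive.
Import Order.TTheory GRing.Theory Num.Theory.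
Local Open Scope ring_scope.

Section PoissonDefs.
Variables (k : fieldType) (n r : nat).
Local Notation A := {mpoly k[n]}.

(* B_i = k[x_0, ..., x_{i-1}] (0-based variables 'X_0 .. 'X_{n-1}) as a subset of A *)
Definition in_sub (i : nat) (p : A) : Prop :=
  forall m, m \in msupp p -> forall j : 'I_n, (i <= j)%N -> m j = 0%N.

Record is_poisson_bracket (br : A -> A -> A) : Prop := {
  pb_linl : forall (l : k) a b c, br (l *: a + b) c = l *: br a c + br b c;
  pb_linr : forall (l : k) a b c, br a (l *: b + c) = l *: br a b + br a c;
  pb_alt : forall a, br a a = 0;
  pb_jacobi : forall a b c, br a (br b c) + br b (br c a) + br c (br a b) = 0;
  pb_leibl : forall a b c, br (a * b) c = br a c * b + a * br b c;
  pb_leibr : forall a b c, br a (b * c) = br a b * c + b * br a c }.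

Definition derivation_on (B : A -> Prop) (d : A -> A) : Prop :=
  [/\ forall a, B a -> B (d a),
      forall (l : k) a b, B a -> B b -> d (l *: a + b) = l *: d a + d b &
      forall a b, B a -> B b -> d (a * b) = d a * b + a * d b].

Definition poisson_derivation_on (br : A -> A -> A) (B : A -> Prop) (d : A -> A) :=
  derivation_on B d /\
  forall a b, B a -> B b -> d (br a b) = br (d a) b + br a (d b).

(* A = k[x_1][x_2;alpha_2,delta_2]_p ... [x_n;alpha_n,delta_n]_p, with x_i = 'X_(i-1).
   The step for the (0-based) variable i >= 1 extends B = in_sub i. *)
Definition iterated_poisson (br : A -> A -> A) (alpha delta : 'I_n -> A -> A) :=
  is_poisson_bracket br /\
  forall i : 'I_n, (0 < i)%N ->
    [/\ poisson_derivation_on br (in_sub i) (alpha i),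
        derivation_on (in_sub i) (delta i),
        (forall a b, in_sub i a -> in_sub i b ->
           delta i (br a b) = br (delta i a) b + br a (delta i b)
                              + alpha i a * delta i b - delta i a * alpha i b) &
        (forall b, in_sub i b -> br 'X_i b = alpha i b * 'X_i + delta i b)].

Definition torus_elt (h : 'I_r -> k) : Prop := forall i, h i != 0.
Definition torus_mul (g h : 'I_r -> k) : 'I_r -> k := fun i => g i * h i.
Definition torus_one : 'I_r -> k := fun _ => 1.

Definition char_val (m : 'I_r -> int) (h : 'I_r -> k) : k := \prod_(i < r) h i ^ m i.

Definition kalg_aut (f : A -> A) : Prop :=
  [/\ forall (l : k) a b, f (l *: a + b) = l *: f a + f b,
      forall a b, f (a * b) = f a * f b,
      f 1 = 1 & bijective f].

Definition torus_action (act : ('I_r -> k) -> A -> A) : Prop :=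
  [/\ forall h, torus_elt h -> kalg_aut (act h),
      forall a, act torus_one a = a &
      forall g h a, torus_elt g -> torus_elt h ->
        act (torus_mul g h) a = act g (act h a)].

Definition in_eigen (act : ('I_r -> k) -> A -> A) (m : 'I_r -> int) (a : A) : Prop :=
  forall h, torus_elt h -> act h a = char_val m h *: a.

(* rational action: A is the direct sum of the eigenspaces A_m, m in Z^r *)
Definition rational_action (act : ('I_r -> k) -> A -> A) : Prop :=
  torus_action act /\
  (forall a, exists N (ms : 'I_N -> 'I_r -> int) (as_ : 'I_N -> A),
      (forall j, in_eigen act (ms j) (as_ j)) /\ a = \sum_(j < N) as_ j) /\
  (forall N (ms : 'I_N -> 'I_r -> int) (as_ : 'I_N -> A),
      (forall j j', j != j' -> ms j <> ms j') ->
      (forall j, in_eigen act (ms j) (as_ j)) ->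
      \sum_(j < N) as_ j = 0 -> forall j, as_ j = 0).

Definition is_H_eigenvector (act : ('I_r -> k) -> A -> A) (a : A) : Prop :=
  a != 0 /\ exists lam : ('I_r -> k) -> k, forall h, torus_elt h -> act h a = lam h *: a.

(* (eta | m) : eigenvalue of eta in Lie H = k^r on A_m *)
Definition eta_val (eta : 'I_r -> k) (m : 'I_r -> int) : k :=
  \sum_(i < r) eta i * (m i)%:~R.

Definition is_ideal (I : A -> Prop) : Prop :=
  [/\ I 0, forall a b, I a -> I b -> I (a + b) & forall a b, I b -> I (a * b)].

Definition is_prime_ideal (I : A -> Prop) : Prop :=
  [/\ is_ideal I, ~ I 1 & forall a b, I (a * b) -> I a \/ I b].

Definition is_poisson_prime (br : A -> A -> A) (I : A -> Prop) : Prop :=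
  is_prime_ideal I /\ forall a b, I b -> I (br a b).

Definition H_stable (act : ('I_r -> k) -> A -> A) (I : A -> Prop) : Prop :=
  forall h, torus_elt h -> forall a, I a -> I (act h a).

End PoissonDefs.

(* Main.v *)
Require Import Defs.
From HB Require Import structures.
From mathcomp Require Import all_boot all_order all_algebra.
From mathcomp Require Import mpoly ring.
From Stdlib Require Import Classical.
Set Implicit Arguments. Unset Strict Implicit. Unset Printing Implicit Defensive.
Import Order.TTheory GRing.Theory Num.Theory.
Local Open Scope ring_scope.

(** Adjoin the variables one at a time: [B = k[x_1..x_(i-1)]], [x = x_i].  An
    H-stable ideal is stable under the Euler derivation [eta] given by [eta_i],
    which extends [alpha_i] to the whole algebra and satisfies [eta x = mu x]
    with [mu <> 0].  Let [I] be an H-stable Poisson prime, [Q] its intersection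
    with [B] and [K] the fraction field of [B/Q].  If [I] does not meet [B[x]]
    in [Q[x]], it generates a proper nonzero ideal of [K[x]]; stability under
    [eta] and under brackets with [B] forces the generator to have degree one,
    [y = x + d], with [eta d = mu d] and [{y,c} = eta(c) y] on [K].  Two such
    elements differ by some [e] in [K] with [{e,c} = e eta(c)]; taking [c = e]
    gives [mu e^2 = 0].  Hence, above every [Q] there are at most two traces of
    [I] on [B[x]], and [I] is determined by [n] binary choices.  Clearing
    denominators keeps every computation inside the polynomial ring. *)

Lemma first_failure (P : nat -> Prop) N :
  P 0%N -> ~ P N -> exists n, P n /\ ~ P n.+1.
Proof.
move=> P0; elim: N => // N IHN PN1.
by case: (classic (P N)) => [PN|/IHN //]; exists N.
Qed.

(** * Derivations of a commutative ring *)

Section Derivations.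

Variable A : comNzRingType.
Implicit Types (a b c x : A) (d : A -> A) (F : {poly A}).

Record derivation d : Prop := Derivation {
  derD : forall a b, d (a + b) = d a + d b;
  derM : forall a b, d (a * b) = d a * b + a * d b }.

Lemma der0 d : derivation d -> d 0 = 0.
Proof. by case=> dD _; apply: (addrI (d 0)); rewrite -dD !addr0. Qed.

Lemma derN d a : derivation d -> d (- a) = - d a.
Proof.
by move=> dd; apply/eqP; rewrite -addr_eq0 -(derD dd) addNr der0.
Qed.

Lemma der1 d : derivation d -> d 1 = 0.
Proof.
case=> _ dM; apply: (addrI (d 1)); rewrite addr0.
by rewrite -[in RHS](mulr1 1) dM mulr1 mul1r.
Qed.

Lemma der_nat d n : derivation d -> d n%:R = 0.
Proof.
move=> dd; elim: n => [|n IHn]; first exact: der0.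
by rewrite -natr1 (derD dd) IHn der1 // addr0.
Qed.

Lemma der_coef d F i : derivation d -> (map_poly d F)`_i = d F`_i.
Proof. by move=> dd; apply: coef_map_id0; apply: der0. Qed.

(** Chain rule. Applied to brackets with a fixed element, to [eta] and to the operator [T], it turns
    [d F.[x]] back into a polynomial expression in [x]. *)
Lemma der_horner d F x :
  derivation d -> d F.[x] = (map_poly d F).[x] + F^`().[x] * d x.
Proof.
move=> dd; elim/poly_ind: F => [|F a IHF].
  by rewrite map_poly0 deriv0 !horner0 mul0r addr0 der0.
have -> : map_poly d (F * 'X + a%:P) = map_poly d F * 'X + (d a)%:P.
  apply/polyP=> i; rewrite der_coef // !coefD !coefMX !coefC (derD dd).
  by case: i => [|i] /=; rewrite (der0 dd) ?der_coef.
rewrite derivD derivM derivX derivC !hornerE (derD dd) (derM dd) IHF.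
by ring.
Qed.

End Derivations.

(** * One extension step: stable primes and their traces on [B[x]] *)

Section PoissonStep.

Variables (A : comNzRingType) (B : A -> Prop) (br : A -> A -> A).
Variables (eta : A -> A) (x mu : A).
Implicit Types (a b c p q : A) (F G : {poly A}) (I J : A -> Prop).

Let dl b := br x b - eta b * x.

(** Here [eta] plays the role of [alpha_i], extended to the whole ring, and [dl] that of [delta_i],
    so that [{x,b} = eta(b) x + dl(b)]. *)
Record ore_step : Prop := OreStep {
  st_nat : forall n, B n%:R;
  stD : forall a b, B a -> B b -> B (a + b);
  stN : forall a, B a -> B (- a);
  stM : forall a b, B a -> B b -> B (a * b);
  st_br : forall a b, B a -> B b -> B (br a b);
  st_eta : forall a, B a -> B (eta a);
  st_mu : B mu;
  st_dl : forall b, B b -> B (br x b - eta b * x);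
  st_derr : forall a, derivation (br a);
  st_alt : forall a, br a a = 0;
  st_anti : forall a b, br a b = - br b a;
  st_deta : derivation eta;
  st_etax : eta x = mu * x }.

(** [sp_nat] gives the quotient by [I] characteristic zero, and its instance [n = 0] makes [I]
    proper. [sp_eta] is the form in which H-stability enters the step. *)
Record stable_prime I : Prop := StablePrime {
  spD : forall a b, I a -> I b -> I (a + b);
  spM : forall a b, I b -> I (a * b);
  spP : forall a b, I (a * b) -> I a \/ I b;
  sp_br : forall a b, I b -> I (br a b);
  sp_eta : forall a, I a -> I (eta a);
  sp_nat : forall n, ~ I n.+1%:R;
  sp_mu : ~ I mu }.

Definition over_base F := forall i, B F`_i.

(* [I] meets [B[x]] exactly in the extension of [I] intersected with [B]. *)
Definition extended I :=
  forall F, over_base F -> I F.[x] -> forall i, I F`_i.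

Hypothesis st : ore_step.

Let derr := st_derr st.
Let anti := st_anti st.
Let deta := st_deta st.

Let derl b : derivation (br^~ b).
Proof.
split=> a a'; rewrite ![br _ b]anti; first by rewrite (derD (derr _)) opprD.
by rewrite (derM (derr _)); ring.
Qed.

Let brx b : br x b = eta b * x + dl b.
Proof. by rewrite /dl; ring. Qed.

Lemma extended_horner I F : stable_prime I -> (forall i, I F`_i) -> I F.[x].
Proof.
move=> sI IF; rewrite horner_coef.
have I0 : I 0 by rewrite -(mul0r F`_0); apply: spM.
elim/big_ind: _ => //; first exact: spD.
by move=> i _; rewrite mulrC; apply: spM.
Qed.

(** Division by [a x + b] over the fraction field, cleared of denominators: the factor [a ^+ m]
    replaces inverting [a]. *)
Lemma linear_pseudo_division a b F : B a -> B b ->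
  over_base F -> exists m q c, B c /\ a ^+ m * F.[x] = q * (a * x + b) + c.
Proof.
move=> Ba Bb; elim/poly_ind: F => [|F c IHF] BF.
  exists 0%N, 0, 0; split; first exact: (st_nat st 0).
  by rewrite horner0; ring.
have BF' : over_base F.
  by move=> i; have := BF i.+1; rewrite coefD coefMX coefC addr0.
have Bc : B c by have := BF 0%N; rewrite coefD coefMX coefC add0r.
have [m [q [e [Be eqF]]]] := IHF BF'.
have Bam : B (a ^+ m).
  by elim: m {eqF} => [|m IHm]; [exact: (st_nat st 1)|rewrite exprS; apply: (stM st)].
exists m.+1, (a * q * x + e), (a * a ^+ m * c - e * b); split.
  apply: (stD st); last by apply/(stN st)/(stM st).
  by apply: (stM st) => //; apply: (stM st).
rewrite hornerMXaddC exprS.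
have -> : a * a ^+ m * (F.[x] * x + c) = a * x * (a ^+ m * F.[x]) + a * a ^+ m * c by ring.
by rewrite eqF; ring.
Qed.

Section OnePrime.

Variable I : A -> Prop.
Hypothesis sI : stable_prime I.

Let IM a b : I b -> I (a * b). Proof. exact: spM. Qed.
Let ID a b : I a -> I b -> I (a + b). Proof. exact: spD. Qed.
Let IN a : I a -> I (- a).
Proof. by rewrite -mulN1r; apply: IM. Qed.
Let IB a b : I a -> I b -> I (a - b).
Proof. by move=> Ia /IN; apply: ID. Qed.

Let Icancel a b : ~ I a -> I (a * b) -> I b.
Proof. by move=> nIa /(spP sI) []. Qed.

Let Inat n a : I (a *+ n.+1) -> I a.
Proof. by rewrite -mulr_natl; apply/Icancel/sp_nat. Qed.

(** This [F], of degree [n+1], stands for the generator of least degree over the fraction field. The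
    degree is at least one because a constant relation has its only coefficient in [I]. *)
Lemma minimal_relation :
  ~ extended I ->
  exists n F, [/\ over_base F, (size F <= n.+2)%N, ~ I F`_n.+1, I F.[x] &
    forall G, over_base G -> (size G <= n.+1)%N -> I G.[x] -> forall i, I G`_i].
Proof.
move=> nextI.
pose P n := forall G, over_base G -> (size G <= n)%N -> I G.[x] -> forall i, I G`_i.
have P1 : P 1%N.
  move=> G BG sG; rewrite (size1_polyC sG) hornerC => IG i.
  by rewrite coefC; case: ifP => // _; rewrite -(mul0r G`_0); apply: IM.
have [N nPN] : exists N, ~ P N.+1.
  apply: NNPP => allP; apply: nextI => F BF IF; apply: NNPP => nIF.
  apply: allP; exists (size F) => /(_ F BF (leqnSn _) IF) IF'.
  exact: nIF.
have [n [Pn nPn]] := @first_failure (fun n => P n.+1) N P1 nPN.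
have [F nF] := not_all_ex_not _ _ nPn.
have [BF nF1] := imply_to_and _ _ nF.
have [sF nF2] := imply_to_and _ _ nF1.
have [IF nF3] := imply_to_and _ _ nF2.
exists n, F; split=> // IFn; apply: nF3.
(* If the leading coefficient were in [I], dropping the leading term would leave a shorter relation,
   with coefficients in [I] by minimality; then all those of [F] would be in [I]. *)
pose G := F - F`_n.+1 *: ('X ^+ n.+1).
have coefG i : G`_i = if i == n.+1 then 0 else F`_i.
  rewrite coefB coefZ coefXn; case: eqP => [->|_].
    by rewrite mulr1 subrr.
  by rewrite mulr0 subr0.
have IG : forall i, I G`_i.
  apply: Pn.
  - move=> i; rewrite coefG; case: eqP => // _; exact: (st_nat st 0).
  - apply/leq_sizeP => j ltnj; rewrite coefG; case: eqP => // /eqP nj.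
    by apply/(leq_sizeP _ _ sF); rewrite ltn_neqAle eq_sym nj.
  - by rewrite !hornerE; apply: IB => //; rewrite mulrC; apply: IM.
move=> i; have := IG i; rewrite coefG; case: eqP => // -> _.
exact: IFn.
Qed.

(* In the fraction field of [B/(I meet B)], [I] is generated by a monic [f] of
   degree [n+1]; comparing [f] with [{f,c}] and [eta f] shows that
   [y = g / ((n+1) c0)] satisfies [{y,-} = y (eta - mu y d/dy)], so
   [y^2 f' = 0] modulo [f], and [f'] has too small a degree to lie in [I]. *)
Lemma linear_relation :
  ~ extended I -> exists a b, [/\ B a, B b, ~ I a & I (a * x + b)].
Proof.
move=> /minimal_relation [n [F [BF sF nIc0 IF minF]]].
have Fz j : (n.+1 < j)%N -> F`_j = 0 by apply/leq_sizeP.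
set c0 := F`_n.+1 in nIc0; pose c1 := F`_n.
have Bc0 : B c0 by apply: BF.
have Bc1 : B c1 by apply: BF.
(* By minimality every relation of degree at most [n+1] is proportional to [F] modulo [I]; only the
   two top coefficients are compared. *)
have ratio G : over_base G -> (size G <= n.+2)%N -> I G.[x] ->
    I (c0 * G`_n - G`_n.+1 * c1).
  move=> BG sG IG.
  have := minF (c0 *: G - G`_n.+1 *: F) _ _ _ n; rewrite coefB !coefZ; apply.
  - by move=> i; rewrite coefB !coefZ; apply: (stD st); [|apply: (stN st)]; apply: (stM st).
  - apply/leq_sizeP => j; rewrite leq_eqVlt coefB !coefZ => /orP[/eqP<-|ltnj].
      by rewrite mulrC subrr.
    have -> : G`_j = 0 by apply: (leq_sizeP _ _ sG).
    by rewrite Fz // !mulr0 subrr.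
  - by rewrite !hornerE; apply: IB; apply: IM.
have Bmuln a m : B a -> B (a *+ m).
  by move=> Ba; rewrite -mulr_natl; apply: (stM st) => //; apply: st_nat.
have Bdl c : B c -> B (dl c) by apply: st_dl.
have relbr c : B c -> I (c0 * (br c1 c + c1 * eta c *+ n + c0 * dl c *+ n.+1)
                         - (br c0 c + c0 * eta c *+ n.+1) * c1).
  move=> Bc.
  pose G := map_poly (br^~ c) F + F^`() * (eta c *: 'X + (dl c)%:P).
  have coefG i : G`_i = br F`_i c + F`_i * eta c *+ i + F`_i.+1 * dl c *+ i.+1.
    rewrite coefD (der_coef _ _ (derl c)) mulrDr -scalerAr coefD coefZ coefMX.
    rewrite coefMC !coef_deriv addrA; congr (_ + _ + _); last by rewrite mulrnAl.
    by case: i => [|i] /=; rewrite ?mulr0 ?mulr0n // mulrnAr mulrC.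
  have := ratio G; rewrite !coefG -/c0 -/c1.
  have -> : F`_n.+2 = 0 by apply: Fz.
  rewrite mul0r mul0rn addr0; apply.
  - move=> i; rewrite coefG; apply: (stD st); [apply: (stD st)|].
    + exact: st_br.
    + by apply/Bmuln/(stM st) => //; apply: st_eta.
    + by apply/Bmuln/(stM st) => //; apply: Bdl.
  - apply/leq_sizeP => j ltnj; rewrite coefG.
    rewrite !Fz // ?leqW //.
    by rewrite (der0 (derl c)) !mul0r !mul0rn !addr0.
  - have -> : G.[x] = - br c F.[x].
      rewrite -anti (der_horner _ _ (derl c)) /= brx.
      by rewrite /G hornerD hornerM !hornerE.
    by apply: IN; apply: sp_br.
have releta : I (c0 * eta c1 - c1 * eta c0 - mu * c0 * c1).
  pose G := map_poly eta F + mu *: (F^`() * 'X).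
  have coefG i : G`_i = eta F`_i + mu * F`_i *+ i.
    rewrite coefD (der_coef _ _ deta) coefZ coefMX coef_deriv; congr (_ + _).
    by case: i => [|i] /=; rewrite ?mulr0 ?mulr0n // mulrnAr.
  have := ratio G; rewrite !coefG -/c0 -/c1.
  have -> : c0 * (eta c1 + mu * c1 *+ n) - (eta c0 + mu * c0 *+ n.+1) * c1 =
    c0 * eta c1 - c1 * eta c0 - mu * c0 * c1.
    by ring.
  apply.
  - move=> i; rewrite coefG; apply: (stD st); first exact: st_eta.
    by apply/Bmuln/(stM st) => //; apply: st_mu.
  - apply/leq_sizeP => j ltnj; rewrite coefG Fz //.
    by rewrite (der0 deta) mulr0 mul0rn addr0.
  - have -> : G.[x] = eta F.[x].
      by rewrite (der_horner _ _ deta) /G (st_etax st) hornerD hornerZ hornerMX; ring.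
    exact: sp_eta.
(* Divided by [N c0], [g] becomes [x + c1/((n+1) c0)], the shift that removes the second coefficient
   of the monic generator. *)
pose N : A := n.+1%:R.
pose g := N * c0 * x + c1.
have brg p : br g p = N * (br c0 p * x + c0 * br x p) + br c1 p.
  have d := derl p; rewrite /g (derD d) !(derM d) (der_nat _ d); ring.
(* [T p] is [c0^2] times [{g/c0, p} - (g/c0) eta(p)]; this derivation vanishes on [B] modulo [I]. *)
pose T p := c0 * br g p - g * br c0 p - c0 * g * eta p.
have derT : derivation T.
  split=> a b; rewrite /T.
    by rewrite !(derD (derr _)) (derD deta); ring.
  by rewrite !(derM (derr _)) (derM deta); ring.
have relT c : B c -> I (T c).
  move=> Bc; have -> // : T c = c0 * (br c1 c + c1 * eta c *+ n + c0 * dl c *+ n.+1)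
                         - (br c0 c + c0 * eta c *+ n.+1) * c1.
    by rewrite /T brg brx /g /N; ring.
  exact: relbr.
(* Modulo [I], [{g,g} = 0] and [eta(g/c0) = mu g/c0] give [T g = - mu c0 g^2], while
   [T g = N c0 T x] because [T] kills [c0] and [c1]. *)
have relTx : I (N * T x + mu * g ^+ 2).
  have nIc00 : ~ I (c0 * c0) by move=> /(Icancel nIc0).
  apply: (Icancel nIc00).
  have cE c : br c x = - (eta c * x + dl c) by rewrite anti brx.
  have -> : c0 * c0 * (N * T x + mu * g ^+ 2) = c1 * T c0 - c0 * T c1
      - (c0 * c1 + N * x * c0 * c0) * (c0 * eta c1 - c1 * eta c0 - mu * c0 * c1).
    by rewrite /T !brg !(st_alt st) (st_etax st) !brx !cE (anti c1 c0) /g; ring.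
  by apply: IB; [apply: IB|]; apply: IM => //; apply: relT.
(* In the chain rule for [T F.[x]] the coefficients contribute nothing modulo [I], and the value of
   [N T x] leaves [F'(x) mu g^2] up to sign. *)
have : I (N * T F.[x]).
  apply: IM; apply: IB; first apply: IB; apply: IM; [exact: sp_br..|exact: sp_eta].
rewrite (der_horner _ _ derT) mulrDr => IT.
have IF'g : I (F^`().[x] * (mu * (g * g))).
  have IT' : I (N * (map_poly T F).[x]).
    apply: IM; apply: extended_horner => // i; rewrite (der_coef _ _ derT).
    exact: relT.
  have -> : F^`().[x] * (mu * (g * g)) =
    F^`().[x] * (N * T x + mu * g ^+ 2) + N * (map_poly T F).[x]
    - (N * (map_poly T F).[x] + N * (F^`().[x] * T x)) by ring.
  by apply: IB => //; apply: ID => //; apply: IM.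
(* The coefficient of degree [n] in [F'] is [(n+1) c0], so [F'(x)] in [I] would contradict
   minimality. *)
have nIF' : ~ I F^`().[x].
  move=> /(minF F^`()) IF'; apply: nIc0; apply: (@Inat n).
  rewrite /c0 -coef_deriv; apply: IF' => [i|].
    by rewrite coef_deriv; apply: Bmuln.
  apply/leq_sizeP => j ltnj; rewrite coef_deriv Fz ?mul0rn //.
have Ig : I g.
  by have /(Icancel (sp_mu sI))/(spP sI) [] := Icancel nIF' IF'g.
exists (N * c0), c1; split=> //; first by apply: (stM st) => //; apply: st_nat.
by move=> /(Icancel (@sp_nat _ sI n)).
Qed.

(** * Linear elements: their relations and uniqueness *)

Section LinearElement.

Variables a b : A.
Hypothesis Iab : I (a * x + b).

(** Bracket [a x + b] with [c] and eliminate [x]. For [d = b/a] this is [{d,c} + dl c = d eta(c)],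
    multiplied by [a^2]. *)
Lemma linear_relation_br c :
  I (a * (a * dl c + br b c) - b * (br a c + a * eta c)).
Proof.
have -> : a * (a * dl c + br b c) - b * (br a c + a * eta c) =
    a * br (a * x + b) c - (br a c + a * eta c) * (a * x + b).
  by rewrite (derD (derl c)) (derM (derl c)) brx; ring.
apply: IB; apply: IM => //; rewrite anti; apply: IN; exact: sp_br.
Qed.

(** The same elimination for [eta]: with [d = b/a] it is [eta d = mu d], multiplied by [a^2]. *)
Lemma linear_relation_eta : I (a * eta b - b * (eta a + mu * a)).
Proof.
have -> : a * eta b - b * (eta a + mu * a) =
    a * eta (a * x + b) - (eta a + mu * a) * (a * x + b).
  by rewrite (derD deta) (derM deta) (st_etax st); ring.
by apply: IB; apply: IM => //; apply: sp_eta.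
Qed.

End LinearElement.
End OnePrime.

(** With [s = a a'], the fraction [e/s] is [b/a - b'/a']. Modulo [I] it satisfies
    [{e/s, c} = (e/s) eta(c)] and [eta(e/s) = mu e/s], and [c = e/s] gives [mu (e/s)^2 = 0]. *)
Lemma linear_relation_unique I J a b a' b' :
    stable_prime I -> stable_prime J -> (forall c, B c -> I c <-> J c) ->
    B a -> B b -> I (a * x + b) -> B a' -> B b' -> J (a' * x + b') ->
    ~ I a -> ~ I a' ->
  I (a' * b - a * b').
Proof.
move=> sI sJ IJ Ba Bb Iab Ba' Bb' Jab' nIa nIa'.
pose s := a * a'; pose e := a' * b - a * b'; rewrite -/e.
have BD := stD st; have BN := stN st; have BM := stM st; have Bbr := st_br st.
have Beta := st_eta st; have Bmu := st_mu st.
have Bdl c : B c -> B (dl c) := st_dl st (b := c).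
have Bs : B s by apply/BM.
have Be : B e by apply/BD/BN; auto.
have IM c d : I d -> I (c * d) by apply: spM.
have IB c d : I c -> I d -> I (c - d).
  by move=> Ic Id; rewrite -mulN1r; apply: (spD sI) => //; apply: IM.
have Icancel c d : ~ I c -> I (c * d) -> I d by move=> nIc /(spP sI) [].
have rel c : B c -> I (s * br e c - e * br s c - s * e * eta c).
  move=> Bc.
  have R := linear_relation_br sI Iab c.
  (* This element lies in [B], where [I] and [J] agree, so a relation coming from [J] may be used
     modulo [I]. *)
  have /IJ R' : J (a' * (a' * dl c + br b' c) - b' * (br a' c + a' * eta c)).
    exact: linear_relation_br.
  have -> : s * br e c - e * br s c - s * e * eta c =
     a' * a' * (a * (a * dl c + br b c) - b * (br a c + a * eta c)) -
     a * a * (a' * (a' * dl c + br b' c) - b' * (br a' c + a' * eta c)).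
    have d := derl c; rewrite /e /s (derD d) (derN _ d) !(derM d); ring.
  apply: IB; apply: IM => //; apply: R'.
  by auto 10.
have releta : I (s * eta e - e * eta s - mu * s * e).
  have R := linear_relation_eta sI Iab.
  have /IJ R' : J (a' * eta b' - b' * (eta a' + mu * a')).
    exact: linear_relation_eta.
  have -> : s * eta e - e * eta s - mu * s * e =
      a' * a' * (a * eta b - b * (eta a + mu * a))
      - a * a * (a' * eta b' - b' * (eta a' + mu * a')).
    by rewrite /e /s (derD deta) (derN _ deta) !(derM deta); ring.
  apply: IB; apply: IM => //; apply: R'.
  by auto 10.
have nIs : ~ I s by move=> /(Icancel _ _ nIa).
(* As [e/s] need not lie in [B], the substitution [c = e/s] is carried out by combining [rel s] and
   [rel e] as in the quotient rule. *)
have : I (mu * (s * (s * (e * e)))).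
  have -> : mu * (s * (s * (e * e))) = e * (s * br e s - e * br s s - s * e * eta s)
     - s * (s * br e e - e * br s e - s * e * eta e)
     - s * e * (s * eta e - e * eta s - mu * s * e).
    by rewrite !(st_alt st) (anti e s); ring.
  by apply: (IB); [apply: (IB)|]; apply: (IM) => //; apply: rel.
move=> /(Icancel _ _ (sp_mu sI)) /(Icancel _ _ nIs) /(Icancel _ _ nIs).
by move=> /(spP sI) [].
Qed.

(** If both primes are extended, membership is read off the coefficients in [B]. Otherwise both
    contain a linear element, and division by the one in [I] leaves a remainder in [B], where the
    primes agree. *)
Lemma step_determined I J F :
    stable_prime I -> stable_prime J -> (forall c, B c -> I c <-> J c) ->
    (extended I <-> extended J) ->
  over_base F -> I F.[x] -> J F.[x].
Proof.
move=> sI sJ IJ eIJ BF IF; have [eI|neI] := classic (extended I).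
  by apply: extended_horner => // i; apply/IJ => //; apply: eI.
have neJ : ~ extended J by move=> /eIJ.
have [a [b [Ba Bb nIa Iab]]] := linear_relation sI neI.
have [a' [b' [Ba' Bb' nJa' Jab']]] := linear_relation sJ neJ.
have nJa : ~ J a by move/IJ => /(_ Ba).
have nIa' : ~ I a' by move/IJ => /(_ Ba').
have Ie := linear_relation_unique sI sJ IJ Ba Bb Iab Ba' Bb' Jab' nIa nIa'.
have Je : J (a' * b - a * b').
  apply/IJ => //.
  by apply: (stD st); [|apply: (stN st)]; apply: (stM st).
have Jcancel c d : ~ J c -> J (c * d) -> J d by move=> nJc /(spP sJ) [].
have [m [q [c [Bc eqF]]]] := linear_pseudo_division Ba Bb BF.
have Jc : J c.
  apply/IJ => //; have -> : c = a ^+ m * F.[x] + (- q) * (a * x + b).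
    by rewrite eqF; ring.
  by apply: (spD sI); apply: (spM sI).
(* Modulo [J], [a' (a x + b)] equals [a (a' x + b')] and so vanishes, although [a x + b] was chosen
   in [I]. *)
have : J (a' * (a ^+ m * F.[x])).
  have -> : a' * (a ^+ m * F.[x]) =
      q * (a' * b - a * b') + q * a * (a' * x + b') + a' * c.
    by rewrite eqF; ring.
  by do 2?[apply: (spD sJ)]; apply: (spM sJ).
move/(Jcancel _ _ nJa'); elim: m {eqF} => [|m IHm]; first by rewrite expr0 mul1r.
by rewrite exprS -mulrA => /(Jcancel _ _ nJa).
Qed.

End PoissonStep.

(** * Subalgebras of the first variables, and Euler derivations *)

Section Subalgebras.

Variables (k : fieldType) (n : nat).
Local Notation A := {mpoly k[n]}.
Implicit Types (a b p q : A) (i : nat) (j : 'I_n) (rho : 'I_n -> k).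

Lemma in_subC i (l : k) : in_sub i (l%:MP_[n]).
Proof.
move=> m; rewrite msuppC; case: eqP => // _; rewrite inE => /eqP-> j _.
by rewrite mnm0E.
Qed.

Lemma in_subD i p q : in_sub i p -> in_sub i q -> in_sub i (p + q).
Proof.
by move=> Bp Bq m /msuppD_le; rewrite mem_cat => /orP[/Bp|/Bq].
Qed.

Lemma in_subM i p q : in_sub i p -> in_sub i q -> in_sub i (p * q).
Proof.
move=> Bp Bq m /msuppM_le /allpairsP [[m1 m2] /= [/Bp B1 /Bq B2 ->]] j leij.
by rewrite mnmDE B1 ?B2.
Qed.

Lemma in_subZ i (l : k) p : in_sub i p -> in_sub i (l *: p).
Proof. by move=> Bp m /msuppZ_le /Bp. Qed.

Lemma in_subN i p : in_sub i p -> in_sub i (- p).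
Proof. by rewrite -scaleN1r; apply: in_subZ. Qed.

Lemma in_subX i j : (j < i)%N -> in_sub i ('X_j : A).
Proof.
move=> ltji m; rewrite msuppX inE => /eqP-> j' leij'; rewrite mnm1E.
by case: eqP leij' => // <-; rewrite leqNgt ltji.
Qed.

Lemma in_subW i i' p : (i <= i')%N -> in_sub i p -> in_sub i' p.
Proof. by move=> leii' Bp m /Bp Bm j le_i'j; apply: Bm; apply: leq_trans le_i'j. Qed.

Lemma in_sub_ind i (K : A -> Prop) p :
    K 1 -> (forall (l : k) a b, K a -> K b -> K (l *: a + b)) ->
    (forall j a, (j < i)%N -> K a -> K ('X_j * a)) ->
  in_sub i p -> K p.
Proof.
move=> K1 KD KX Bp; have K0 : K 0 by rewrite -(addNr 1) -scaleN1r; apply: KD.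
rewrite (mpolyE p) big_seq; elim/big_rec: _ => // m q /Bp Bm Kq; apply: KD => //.
rewrite mpolyXE_id; elim/big_rec: _ => // j a _ Ka.
case: (ltnP j i) => [ltji|/Bm ->]; last by rewrite expr0 mul1r.
by elim: (m j) => [|e IHe]; rewrite ?expr0 ?mul1r // exprS -mulrA; apply: KX.
Qed.

Lemma in_sub0 p : in_sub 0 p -> exists l, p = l%:MP_[n].
Proof.
move=> Bp; elim/in_sub_ind: p / Bp => [|l a b [u ->] [v ->]|//].
  by exists 1; rewrite mpolyC1.
by exists (l * u + v); rewrite mpolyCD mpolyCM mul_mpolyC.
Qed.

Lemma in_subS_horner j p :
  in_sub j.+1 p -> exists F, over_base (in_sub j) F /\ p = F.['X_j].
Proof.
have B0 i : in_sub i (0 : A) by rewrite -mpolyC0; apply: in_subC.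
move=> Bp; elim/in_sub_ind: p / Bp => [|l a b [F [BF ->]] [G [BG ->]]|j' a].
- exists 1; split; last by rewrite hornerC.
  move=> e; rewrite coef1; case: eqP => _ //=.
  by rewrite -mpolyC1; apply: in_subC.
- exists (l%:MP *: F + G); split; last first.
    by rewrite hornerD hornerZ mul_mpolyC.
  move=> e; rewrite coefD coefZ mul_mpolyC.
  by apply: in_subD => //; apply: in_subZ.
rewrite ltnS leq_eqVlt => /orP[/eqP/val_inj->|ltj'j] [F [BF ->]].
  exists (F * 'X); split; last by rewrite hornerMX mulrC.
  by move=> e; rewrite coefMX; case: eqP.
exists ('X_j' *: F); split; last by rewrite hornerZ.
by move=> e; rewrite coefZ; apply: in_subM => //; apply: in_subX.
Qed.

(** The weighted Euler derivation, which scales each ['X_j] by [rho j]. It is a derivation of all of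
    [A], whereas [alpha i] is controlled only on [in_sub i]. *)
Definition euler rho p := \sum_j rho j *: ('X_j * p^`M(j)).

Lemma euler_linear rho (l : k) p q :
  euler rho (l *: p + q) = l *: euler rho p + euler rho q.
Proof.
rewrite /euler scaler_sumr -big_split; apply: eq_bigr => j _ /=.
by rewrite mderivD mderivZ mulrDr scalerDr -scalerAr !scalerA mulrC.
Qed.

Lemma euler_derivation rho : derivation (euler rho).
Proof.
split=> p q; first by have := euler_linear rho 1 p q; rewrite !scale1r.
rewrite /euler mulr_suml mulr_sumr -big_split; apply: eq_bigr => j _ /=.
rewrite mderivM -scalerAl -scalerAr -scalerDr; congr (_ *: _); ring.
Qed.

Lemma euler_monomial rho (m : 'X_{1..n}) :
  euler rho 'X_[m] = (\sum_j rho j *+ m j) *: 'X_[m].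
Proof.
rewrite scaler_suml; apply: eq_bigr => j _.
rewrite mderivX -scalerAr -mpolyXD scalerA mulr_natr.
case: (posnP (m j)) => [->|mj]; first by rewrite mulr0n !scale0r.
by rewrite addmC submK //; apply/mnm_lepP => j'; rewrite mnm1E; case: eqP => // <-.
Qed.

Lemma eulerX rho j : euler rho 'X_j = rho j *: 'X_j.
Proof.
rewrite euler_monomial (bigD1 j) //= mnm1E eqxx mulr1n big1 ?addr0 // => j' nj.
by rewrite mnm1E eq_sym (negPf nj).
Qed.

Lemma in_sub_euler rho i p : in_sub i p -> in_sub i (euler rho p).
Proof.
move=> Bp; have de := euler_derivation rho.
suff [] : in_sub i p /\ in_sub i (euler rho p) by [].
elim/in_sub_ind: p / Bp => [|l a b [Ba Bea] [Bb Beb]|j a ltji [Ba Bea]].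
- by rewrite (der1 de) -mpolyC1 -mpolyC0; split; apply: in_subC.
- by rewrite euler_linear; split; apply: in_subD => //; apply: in_subZ.
have BX := in_subX ltji.
rewrite (derM de) eulerX; split; first exact: in_subM.
by apply: in_subD; apply: in_subM => //; apply: in_subZ.
Qed.

End Subalgebras.

(** * The steps of an iterated Poisson polynomial algebra *)

Section IteratedPoisson.

Variables (k : fieldType) (n : nat).
Local Notation A := {mpoly k[n]}.
Variables (br : A -> A -> A) (alpha delta : 'I_n -> A -> A).
Hypothesis itP : iterated_poisson br alpha delta.
Implicit Types (a b c : A) (i j : 'I_n).

Let pb : is_poisson_bracket br := proj1 itP.

Lemma bracket_derr a : derivation (br a).
Proof.
split=> b c; last exact: pb_leibr.
by have := pb_linr pb 1 a b c; rewrite !scale1r.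
Qed.

Lemma bracket_anti a b : br a b = - br b a.
Proof.
have := pb_alt pb (1 *: a + b).
rewrite (pb_linl pb) !(pb_linr pb) !(pb_alt pb) !scale1r add0r addr0.
by move/eqP; rewrite addr_eq0 => /eqP.
Qed.

(** For [l < j < i], the formula for [{x_j, x_l}] stays in [in_sub i] because [alpha j] and
    [delta j] preserve [in_sub j]; antisymmetry and the Leibniz rule do the rest. *)
Lemma in_sub_bracket i a b : in_sub i a -> in_sub i b -> in_sub i (br a b).
Proof.
move=> Ba Bb.
have B0 : in_sub i (0 : A) by rewrite -mpolyC0; apply: in_subC.
have B1 : in_sub i (1 : A) by rewrite -mpolyC1; apply: in_subC.
have BX j : (j < i)%N -> in_sub i ('X_j : A) by apply: in_subX.
have ltX (j l : 'I_n) : (l < j)%N -> (j < i)%N -> in_sub i (br 'X_j 'X_l).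
  move=> ltlj ltji; have j_gt0 : (0 < j)%N by apply: leq_ltn_trans ltlj.
  have [[[Balpha _ _] _] [Bdelta _ _] _ ->] := proj2 itP j j_gt0; last exact: in_subX.
  apply: in_subD; first (apply: in_subM; last exact: BX).
    by apply: (in_subW (ltnW ltji)); apply/Balpha/in_subX.
  by apply: (in_subW (ltnW ltji)); apply/Bdelta/in_subX.
have XX (j l : 'I_n) : (l < i)%N -> (j < i)%N -> in_sub i (br 'X_j 'X_l).
  move=> ltli ltji; case: (ltngtP j l) => [ltjl|ltlj|/val_inj->].
  - by rewrite bracket_anti; apply/in_subN/ltX.
  - exact: ltX.
  - by rewrite pb_alt.
have Xb j : (j < i)%N -> in_sub i (br 'X_j b).
  move=> ltji; suff [] : in_sub i b /\ in_sub i (br 'X_j b) by [].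
  have d := bracket_derr 'X_j.
  elim/in_sub_ind: b / Bb => [|l u v [Bu Bu'] [Bv Bv']|l u ltli [Bu Bu']].
  - by rewrite (der1 d).
  - by rewrite (pb_linr pb); split; apply: in_subD => //; apply: in_subZ.
  rewrite (derM d); split; first by apply: in_subM => //; apply: BX.
  by apply: in_subD; apply: in_subM => //; [apply: XX|apply: BX].
suff [] : in_sub i a /\ in_sub i (br a b) by [].
elim/in_sub_ind: a / Ba => [|l u v [Bu Bu'] [Bv Bv']|l u ltli [Bu Bu']].
- by rewrite bracket_anti (der1 (bracket_derr b)) oppr0.
- by rewrite (pb_linl pb); split; apply: in_subD => //; apply: in_subZ.
rewrite (pb_leibl pb); split; first by apply: in_subM => //; apply: BX.
by apply: in_subD; apply: in_subM => //; [apply: Xb|apply: BX].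
Qed.

Variables (rho : 'I_n -> k) (i : 'I_n).
Hypothesis alphaE : forall j, (j < i)%N -> alpha i 'X_j = rho j *: 'X_j.

Lemma alpha_euler b : (0 < i)%N -> in_sub i b -> alpha i b = euler rho b.
Proof.
move=> i_gt0 Bb; have [[[_ alin aM] _] _ _ _] := proj2 itP i i_gt0.
have de := euler_derivation rho.
have B1 : in_sub i (1 : A) by rewrite -mpolyC1; apply: in_subC.
suff [] : in_sub i b /\ alpha i b = euler rho b by [].
elim/in_sub_ind: b / Bb => [|l u v [Bu Eu] [Bv Ev]|j u ltji [Bu Eu]].
- split=> //; rewrite (der1 de); apply: (addrI (alpha i 1)); rewrite addr0.
  by rewrite -[in RHS](mulr1 1) aM // mulr1 mul1r.
- rewrite alin // euler_linear Eu Ev; split=> //.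
  by apply: in_subD => //; apply: in_subZ.
have BX := in_subX ltji : in_sub i ('X_j : A).
by rewrite aM // (derM de) alphaE // eulerX Eu; split=> //; apply: in_subM.
Qed.

Lemma iterated_ore_step : ore_step (in_sub i) br (euler rho) 'X_i (rho i)%:MP.
Proof.
have de := euler_derivation rho.
split.
- by move=> e; rewrite -mpolyC_nat; apply: in_subC.
- exact: in_subD.
- exact: in_subN.
- exact: in_subM.
- exact: in_sub_bracket.
- exact: in_sub_euler.
- exact: in_subC.
(* For [i = 0] there is no formula with [alpha] and [delta]; the base consists of constants, killed
   by both the bracket and [euler]. *)
- move=> b Bb; case: (posnP i) => [i0|i_gt0].
    have [l ->] : exists l, b = l%:MP_[n] by apply: in_sub0; rewrite -i0.
    have dC d : derivation d -> (forall (u : k) p, d (u *: p) = u *: d p) -> d l%:MP = 0.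
      by move=> dd dZ; rewrite -[l%:MP]mulr1 mul_mpolyC dZ (der1 dd) scaler0.
    rewrite !dC //; first by rewrite mul0r subr0 -mpolyC0; apply: in_subC.
    + by move=> u p; rewrite -[u *: p]addr0 euler_linear (der0 de) addr0.
    + exact: bracket_derr.
    move=> u p; rewrite -[u *: p]addr0 (pb_linr pb).
    by rewrite (der0 (bracket_derr _)) addr0.
  have [_ [Bdelta _ _] _ brE] := proj2 itP i i_gt0.
  by rewrite brE // alpha_euler // addrC addKr; apply: Bdelta.
- exact: bracket_derr.
- exact: pb_alt.
- exact: bracket_anti.
- exact: de.
- by rewrite eulerX mul_mpolyC.
Qed.

End IteratedPoisson.

(** Serves to merge terms of equal weight into weight components indexed without repetition. *)
Lemma group_by_key (V : nmodType) (T : eqType) (U : choiceType)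
    (s : seq T) (key : T -> U) (F : T -> V) :
  \sum_(u <- undup (map key s)) \sum_(t <- s | key t == u) F t = \sum_(t <- s) F t.
Proof.
rewrite (exchange_big_dep xpredT) //= big_seq [RHS]big_seq; apply: eq_bigr => t st.
rewrite big_mkcond (bigD1_seq (key t)) ?undup_uniq ?mem_undup ?map_f //= eqxx.
by rewrite big1 ?addr0 // => u; rewrite eq_sym => /negPf->.
Qed.

Lemma prime_idealC (k : fieldType) (n : nat) (I : {mpoly k[n]} -> Prop) (l : k) :
  is_prime_ideal I -> I l%:MP <-> l = 0.
Proof.
move=> [[I0 _ IM] nI1 _]; split=> [Il|->]; last by rewrite mpolyC0.
apply: NNPP => /eqP l_neq0; apply: nI1; rewrite -mpolyC1 -(mulVf l_neq0) mpolyCM.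
exact: IM.
Qed.

(** * Rational torus actions and stable ideals *)

Section TorusAction.

Variables (k : fieldType) (n r : nat).
Local Notation A := {mpoly k[n]}.
Variable act : ('I_r -> k) -> A -> A.
Hypotheses (k0 : [pchar k] =i pred0) (ratA : rational_action act).
Implicit Types (a b p : A) (u v : {ffun 'I_r -> int}) (h : 'I_r -> k).

Lemma act_linear h (l : k) a b :
  torus_elt h -> act h (l *: a + b) = l *: act h a + act h b.
Proof. by case: ratA => [[aut _ _] _] /aut []. Qed.

Lemma act_mul h a b : torus_elt h -> act h (a * b) = act h a * act h b.
Proof. by case: ratA => [[aut _ _] _] /aut []. Qed.

Lemma act_one h : torus_elt h -> act h 1 = 1.
Proof. by case: ratA => [[aut _ _] _] /aut []. Qed.

Lemma act_zero h : torus_elt h -> act h 0 = 0.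
Proof.
by move=> th; rewrite -(addNr 1) -scaleN1r act_linear // act_one // scaleN1r addNr.
Qed.

Lemma act_sum h (T : Type) (s : seq T) (P : pred T) (F : T -> A) :
  torus_elt h -> act h (\sum_(t <- s | P t) F t) = \sum_(t <- s | P t) act h (F t).
Proof.
move=> th; elim/big_rec2: _ => [|t a b _ <-]; first exact: act_zero.
by rewrite -{1}[F t]scale1r act_linear // scale1r.
Qed.

Lemma in_eigen_ext (f g : 'I_r -> int) a :
  f =1 g -> in_eigen act f a -> in_eigen act g a.
Proof.
move=> fg ea h /ea ->; congr (_ *: _).
by apply: eq_bigr => t _; rewrite fg.
Qed.

Lemma in_eigen_lin u (l : k) a b :
  in_eigen act u a -> in_eigen act u b -> in_eigen act u (l *: a + b).
Proof.
move=> ea eb h th; rewrite act_linear // ea // eb //.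
by rewrite scalerDr !scalerA mulrC.
Qed.

Lemma in_eigen0 u : in_eigen act u 0.
Proof. by move=> h th; rewrite act_zero // scaler0. Qed.

Lemma in_eigen_sum u (T : eqType) (s : seq T) (P : pred T) (F : T -> A) :
  (forall t, P t -> in_eigen act u (F t)) -> in_eigen act u (\sum_(t <- s | P t) F t).
Proof.
move=> eF; elim/big_rec: _ => [|t a Pt ea]; first exact: in_eigen0.
by rewrite -[F t]scale1r; apply: in_eigen_lin => //; apply: eF.
Qed.

Lemma in_eigen1 : in_eigen act (0 : {ffun 'I_r -> int}) 1.
Proof.
move=> h th; rewrite act_one // /char_val big1 ?scale1r // => t _.
by rewrite ffunE expr0z.
Qed.

Lemma in_eigenM u v a b :
  in_eigen act u a -> in_eigen act v b -> in_eigen act (u + v) (a * b).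
Proof.
move=> ea eb h th; rewrite act_mul // ea // eb // -scalerAl -scalerAr scalerA.
congr (_ *: _); rewrite /char_val -big_split; apply: eq_bigr => t _ /=.
by rewrite ffunE expfzDr.
Qed.

(** In characteristic zero 2 has infinite order among the units of [k], which provides enough torus
    elements to separate characters. *)
Lemma exprz2_inj : injective (fun z : int => (2 : k) ^ z).
Proof.
have natP := (pcharf0P _).1 k0.
have n2 : (2 : k) != 0 by rewrite natP.
have pow1 e : (2 : k) ^+ e = 1 -> e = 0%N.
  rewrite -natrX => /eqP; rewrite -subr_eq0 -[1]/(1%:R) -natrB ?expn_gt0 //.
  rewrite natP subn_eq0; case: e => // e.
  by rewrite -[X in (_ <= X)%N](expn0 2) leq_exp2l.
move=> z1 z2 eqz; apply/eqP; rewrite -subr_eq0; apply/eqP.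
have : (2 : k) ^ (z1 - z2) = 1 by rewrite expfzDr // -invr_expz eqz mulfV // expfz_neq0.
case: (z1 - z2) => e; first by rewrite -exprnP => /pow1->.
by rewrite NegzE -invr_expz -exprnP => /(congr1 GRing.inv); rewrite invrK invr1 => /pow1.
Qed.

Lemma char_separate u v :
  u != v -> exists2 h : 'I_r -> k, torus_elt h & char_val u h != char_val v h.
Proof.
have n2 : (2 : k) != 0 by rewrite ((pcharf0P _).1 k0).
move=> neuv; have [t neuvt] : exists t, u t != v t.
  by apply/existsP; rewrite -negb_forall; apply: contra neuv => /eqfunP/ffunP/eqP.
pose h s := if s == t then 2 else 1 : k.
have hE w : char_val w h = 2 ^ w t.
  rewrite /char_val (bigD1 t) //= /h eqxx big1 ?mulr1 // => s /negPf->.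
  by rewrite exp1rz.
exists h => [s|]; first by rewrite /h; case: ifP => _; [exact: n2|exact: oner_neq0].
by rewrite !hE (inj_eq exprz2_inj).
Qed.

(** Induction on the number of weights: for [h] separating [u] from [v], applying [act h] and
    subtracting [char_val v h] times the element kills the [v]-part and scales [a] by a nonzero
    constant. *)
Lemma stable_ideal_part (I : A -> Prop) u a (s : seq {ffun 'I_r -> int})
    (F : {ffun 'I_r -> int} -> A) :
    is_ideal I -> H_stable act I -> u \notin s ->
    in_eigen act u a -> (forall v, in_eigen act v (F v)) ->
  I (a + \sum_(v <- s) F v) -> I a.
Proof.
move=> [I0 ID IM] hI; have IZ (l : k) b : I b -> I (l *: b).
  by rewrite -mul_mpolyC; apply: IM.
elim: s a F => [|v s IHs] a F; first by rewrite big_nil addr0.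
rewrite inE negb_or big_cons => /andP[neuv us] ea eF Ia.
have [h th nechi] := char_separate neuv.
pose mu w := char_val w h - char_val v h.
have : I (mu u *: a).
  apply: (IHs _ (fun w => mu w *: F w)) => //.
  - by rewrite -[_ *: a]addr0; apply: in_eigen_lin => //; apply: in_eigen0.
  - by move=> w; rewrite -[_ *: _]addr0; apply: in_eigen_lin => //; apply: in_eigen0.
  have := ID _ _ (hI h th _ Ia) (IZ (- char_val v h) _ Ia).
  rewrite -{1}[a]scale1r -{1}[F v]scale1r !act_linear // act_sum // ea // eF //.
  rewrite !scale1r.
  have -> : \sum_(w <- s) act h (F w) = \sum_(w <- s) char_val w h *: F w.
    by apply: eq_bigr => w _; rewrite eF.
  have -> : \sum_(w <- s) mu w *: F w = \sum_(w <- s) char_val w h *: F w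
      + (- char_val v h) *: \sum_(w <- s) F w.
    rewrite scaler_sumr -big_split; apply: eq_bigr => w _ /=.
    by rewrite -scalerDl.
  rewrite /mu scalerDl !scalerDr !scaleNr addrACA; congr (I (_ + _)).
  by rewrite addrACA subrr add0r.
move/(IZ (mu u)^-1); rewrite scalerA mulVf ?scale1r //.
by rewrite subr_eq0.
Qed.

(** The eigenvalue [lam] is an arbitrary function at first. Comparing weight components of [act h a]
    by directness of the sum, a nonzero component of weight [u], fixed before [h], forces
    [lam h = char_val u h]. *)
Lemma eigenvector_weight a :
  is_H_eigenvector act a -> exists u, in_eigen act u a.
Proof.
case=> a_neq0 [lam lamE].
have [_ [decomp indep]] := ratA; have [N [ms [as_ [eas aE]]]] := decomp a.
pose key j : {ffun 'I_r -> int} := finfun (ms j).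
pose s := undup [seq key j | j <- index_enum 'I_N].
pose b u := \sum_(j <- index_enum 'I_N | key j == u) as_ j.
have aE' : a = \sum_(u <- s) b u by rewrite group_by_key.
have eb u : in_eigen act u (b u).
  apply: in_eigen_sum => j /eqP<-; apply: in_eigen_ext (eas j) => t.
  by rewrite ffunE.
have [u su bu] : exists2 u, u \in s & b u != 0.
  apply/hasP; apply: contraR a_neq0 => /hasPn b0.
  by rewrite aE' big_seq big1 // => u /b0; rewrite negbK => /eqP.
exists u => h th; rewrite lamE //; congr (_ *: _).
pose c v := (lam h - char_val v h) *: b v.
have c0 : \sum_(t < size s) c (nth 0 s t) = 0.
  transitivity (\sum_(v <- s) c v); first by rewrite (big_nth 0) big_mkord.
  rewrite /c.
  under eq_bigr do rewrite scalerBl.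
  rewrite sumrB -scaler_sumr -aE' -lamE // {1}aE' act_sum // -sumrB big1 // => v _.
  by rewrite eb // subrr.
have ltus : (index u s < size s)%N by rewrite index_mem.
have /(_ (Ordinal ltus)) /= : forall t : 'I_(size s), c (nth 0 s t) = 0.
  apply: (indep _ (fun t => nth 0 s t)) => // [t t' ne_t eqf|t].
    case/eqP: ne_t; apply: val_inj; apply/eqP.
    rewrite -(nth_uniq 0 (ltn_ord t) (ltn_ord t') (undup_uniq _)).
    by apply/eqP/ffunP => e; rewrite eqf.
  by rewrite -[c _]addr0; apply: in_eigen_lin => //; apply: in_eigen0.
rewrite nth_index // => /eqP.
by rewrite scaler_eq0 (negPf bu) orbF subr_eq0 => /eqP.
Qed.

Variable w : 'I_n -> {ffun 'I_r -> int}.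
Hypothesis eX : forall j, in_eigen act (w j) 'X_j.

Definition weight (m : 'X_{1..n}) : {ffun 'I_r -> int} := \sum_j w j *+ m j.

Lemma in_eigen_monomial m : in_eigen act (weight m) 'X_[m].
Proof.
rewrite mpolyXE_id /weight; elim/big_rec2: _ => [|j u a _ ea]; first exact: in_eigen1.
apply: in_eigenM => //; elim: (m j) => [|e IHe]; first exact: in_eigen1.
by rewrite mulrS exprS; apply: in_eigenM.
Qed.

Variable eta : 'I_r -> k.

Lemma eta_val_weight m : eta_val eta (weight m) = \sum_j eta_val eta (w j) *+ m j.
Proof.
rewrite /eta_val; under [RHS]eq_bigr do rewrite -sumrMnl.
rewrite exchange_big; apply: eq_bigr => t _ /=.
rewrite /weight sum_ffunE rmorph_sum mulr_sumr; apply: eq_bigr => j _.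
by rewrite ffunMnE rmorphMn mulrnAr.
Qed.

(** A stable ideal contains the weight components of its elements, and the Euler derivation acts on
    the component of weight [u] as the scalar [eta_val eta u]. *)
Lemma stable_euler (I : A -> Prop) p :
    is_ideal I -> H_stable act I -> I p ->
  I (euler (fun j => eta_val eta (w j)) p).
Proof.
move=> idI hI Ip; have [I0 ID IM] := idI.
pose s := undup [seq weight m | m <- msupp p].
pose F u := \sum_(m <- msupp p | weight m == u) p@_m *: 'X_[m].
have eF u : in_eigen act u (F u).
  apply: in_eigen_sum => m /eqP<-; rewrite -[_ *: _]addr0.
  by apply: in_eigen_lin; [exact: in_eigen_monomial|exact: in_eigen0].
have pE : p = \sum_(u <- s) F u by rewrite group_by_key -mpolyE.
have IF u : u \in s -> I (F u).
  move=> su; pose s' := [seq v <- s | v != u].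
  apply: (stable_ideal_part (s := s') (F := F)) (eF u) _ _ => //.
    by rewrite mem_filter eqxx.
  by rewrite big_filter -bigD1_seq ?undup_uniq // -pE.
have -> : euler (fun j => eta_val eta (w j)) p = \sum_(u <- s) eta_val eta u *: F u.
  have -> : \sum_(u <- s) eta_val eta u *: F u =
      \sum_(u <- s) \sum_(m <- msupp p | weight m == u)
        p@_m *: (eta_val eta (weight m) *: 'X_[m]).
    apply: eq_bigr => u _; rewrite scaler_sumr; apply: eq_bigr => m /eqP->.
    by rewrite !scalerA mulrC.
  rewrite group_by_key {1}(mpolyE p).
  have de := euler_derivation (fun j => eta_val eta (w j)).
  elim/big_rec2: _ => [|m a b _ <-]; first exact: der0.
  by rewrite euler_linear euler_monomial eta_val_weight.
rewrite big_seq; elim/big_ind: _ => // u su.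
by rewrite -mul_mpolyC; apply/IM/IF.
Qed.

End TorusAction.

(** * Counting the H-stable Poisson primes *)

Theorem theorem1p7 (k : fieldType) (n r : nat)
    (br : {mpoly k[n]} -> {mpoly k[n]} -> {mpoly k[n]})
    (alpha delta : 'I_n -> {mpoly k[n]} -> {mpoly k[n]})
    (act : ('I_r -> k) -> {mpoly k[n]} -> {mpoly k[n]}) :
  [pchar k] =i pred0 ->
  iterated_poisson br alpha delta ->
  rational_action act ->
  (forall i : 'I_n, is_H_eigenvector act 'X_i) ->
  (exists eta : 'I_n -> 'I_r -> k,
      (forall i j : 'I_n, (j < i)%N -> forall m, in_eigen act m 'X_j ->
          alpha i 'X_j = eta_val (eta i) m *: 'X_j) /\
      (forall i : 'I_n, forall m, in_eigen act m 'X_i -> eta_val (eta i) m != 0)) ->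
  exists f : 'I_(2 ^ n) -> ({mpoly k[n]} -> Prop),
    forall I : {mpoly k[n]} -> Prop,
      H_stable act I -> is_poisson_prime br I ->
      exists j, forall a, I a <-> f j a.
Proof.
move=> k0 itP ratA eigX [eta [alphaE eta_neq0]].
have [w eX] := fin_all_exists (fun j => eigenvector_weight ratA (eigX j)).
pose rho i j := eta_val (eta i) (w j).
have st (i : 'I_n) : ore_step (in_sub i) br (euler (rho i)) 'X_i (rho i i)%:MP.
  by apply: (iterated_ore_step itP) => j ltji; apply: alphaE.
have sp (i : 'I_n) I : H_stable act I -> is_poisson_prime br I ->
    stable_prime br (euler (rho i)) (rho i i)%:MP I.
  move=> hI [pI brI]; have [idI _ primeI] := pI; have [_ ID IM] := idI.
  split=> //.
  - by move=> a; apply: (stable_euler k0 ratA eX).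
  - by move=> e; rewrite -mpolyC_nat (prime_idealC _ pI) => /eqP; rewrite ((pcharf0P _).1 k0).
  - by rewrite (prime_idealC _ pI); apply/eqP/eta_neq0.
(* The [i]-th binary choice attached to [I]. *)
pose ext (I : {mpoly k[n]} -> Prop) (i : 'I_n) := extended (in_sub i) 'X_i I.
have determined I J : H_stable act I -> is_poisson_prime br I ->
    H_stable act J -> is_poisson_prime br J ->
    (forall i, ext I i <-> ext J i) -> forall a, I a -> J a.
  move=> hI pI hJ pJ extIJ a.
  (* Agreement starts on the constants, where a prime contains only 0, and spreads one variable at a
     time to all of [A]. *)
  suff /(_ n (leqnn n)) IJ : forall i, (i <= n)%N -> forall b, in_sub i b -> I b <-> J b.
    by move=> Ia; apply/IJ => // m _ j; rewrite leqNgt ltn_ord.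
  elim=> [_ b /in_sub0 [l ->]|i IHi ltin b].
    by rewrite !prime_idealC; [|case: pJ|case: pI].
  pose x : 'I_n := Ordinal ltin.
  move=> /(in_subS_horner (j := x)) [F [BF ->]].
  have IJ := IHi (ltnW ltin).
  have sI := sp x I hI pI; have sJ := sp x J hJ pJ.
  split; first exact: (step_determined (st x) sI sJ IJ (extIJ x) BF).
  apply: (step_determined (st x) sJ sI _ (iff_sym (extIJ x)) BF).
  by move=> c Bc; apply: iff_sym; apply: IJ.
(* [F c] is the union of all the primes with pattern [c]. By [determined] it equals each of them; a
   pattern that does not occur gives the empty set. *)
pose F (c : {ffun 'I_n -> bool}) a :=
  exists2 I, H_stable act I /\ is_poisson_prime br I &
    (forall i, c i <-> ext I i) /\ I a.
have cardF : (2 ^ n)%N = #|{ffun 'I_n -> bool}| by rewrite card_ffun card_bool card_ord.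
exists (fun j => F (enum_val (cast_ord cardF j))) => I hI pI.
have [c cE] : exists c : 'I_n -> bool, forall i, c i <-> ext I i.
  apply: (fin_all_exists (P := fun i (c : bool) => c <-> ext I i)) => i.
  case: (classic (ext I i)) => eI.
    by exists true.
  by exists false.
exists (cast_ord (esym cardF) (enum_rank [ffun i => c i])) => a.
rewrite cast_ordKV enum_rankK; split=> [Ia|[J [hJ pJ] [cJ Ja]]].
  by exists I => //; split=> // i; rewrite ffunE.
apply: (determined J) => // i.
by rewrite -cJ ffunE.
Qed.
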